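(* Let $\mathbb{K}=\{x\in l_2:x_i\ge 0\text{ for all }i\in\mathbb{N}\}$ be the positive cone of the real Hilbert space $l_2$ with origin $\theta$, and let $P_{\mathbb{K}}:l_2\to\mathbb{K}$ be the metric projection onto $\mathbb{K}$. Let $M$ be a nonempty finite subset of $\mathbb{N}$ with complement $\bar{M}=\mathbb{N}\setminus M$. Then the Mordukhovich derivatives of $P_{\mathbb{K}}$ satisfy the following. (i) For any $\bar{x}\in l_2$, $\widehat{D}^*P_{\mathbb{K}}(\bar{x})(\theta)=\{\theta\}$. (ii) Let $\bar{x}\in\mathbb{Z}_M$. For any $y\in l_2$, $y\in\mathbb{K}_{\bar{M}}\iff y\in\widehat{D}^*P_{\mathbb{K}}(\bar{x})(y)$. (iii) Let $\bar{x}\in\mathbb{Z}_M$. For any $y\in\mathbb{K}_{\bar{M}}$, $\widehat{D}^*P_{\mathbb{K}}(\bar{x})(y)=\{z\in\mathbb{K}_{\bar{M}}:z\preccurlyeq_{\bar{M}}y\}$. In particular, $y\in\partial\mathbb{K}_{\bar{M}}\implies\widehat{D}^*P_{\mathbb{K}}(\bar{x})(y)=\{y\}$.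
   Context: $\mathbb{N}$ is the set of positive integers. For a nonempty $N\subseteq\mathbb{N}$ with complement $\bar{N}=\mathbb{N}\setminus N$: $\mathbb{K}_N=\{x\in l_2:x_i\ge 0\text{ for }i\in N\}$; $\partial\mathbb{K}_N=\{x\in\mathbb{K}_N:x_i=0\text{ for }i\in N\}$; $\mathbb{Z}_N=\{x\in l_2:x_i>0\text{ for all }i\in N\text{ and }x_i=0\text{ for all }i\in\bar{N}\}$. The partial order $\preccurlyeq_N$ on $l_2$ is defined by $z\preccurlyeq_N y\iff z_i\le y_i$ for all $i\in N$ and $z_i=y_i$ for all $i\in\bar{N}$. (These are applied with $N=M$ or $N=\bar{M}$; the complement of $\bar{M}$ is $M$.) For a nonempty subset $\Omega$ of a real Hilbert space $X$ and $x\in\Omega$, the set of Fréchet normals is $\widehat{N}(x;\Omega)=\left\{z\in X:\limsup_{u\to x,\ u\in\Omega,\ u\ne x}\frac{\langle z,u-x\rangle}{\|u-x\|}\le 0\right\}$. For a single-valued mapping $f:H\to H$ on a real Hilbert space $H$ (here $H=l_2$), $\bar x\in H$ and $y\in H$, the Mordukhovich derivative (Fréchet coderivative) of $f$ at $\bar x$ is the set $\widehat{D}^*f(\bar x)(y)=\{z\in H:(z,-y)\in\widehat{N}((\bar x,f(\bar x));\mathrm{gph} f)\}$, where $\mathrm{gph} f=\{(u,f(u)):u\in H\}\subseteq H\times H$ and $H\times H$ carries the inner product $\langle(x,y),(u,v)\rangle=\langle x,u\rangle+\langle y,v\rangle$. For a nonempty closed convex $C\subseteq H$, $P_C(x)$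 is the unique point of $C$ with $\|x-P_C(x)\|\le\|x-z\|$ for all $z\in C$. *)

(* Defs.v *)
From HB Require Import structures.
From mathcomp Require Import all_boot all_order all_algebra.
From mathcomp Require Import all_classical all_reals all_analysis.
From mathcomp Require Import ring lra.
Set Implicit Arguments.
Unset Strict Implicit.
Unset Printing Implicit Defensive.
Import Order.TTheory GRing.Theory Num.Theory.
Import numFieldNormedType.Exports.
Local Open Scope classical_set_scope.
Local Open Scope ring_scope.

HB.mixin Record NormedModule_hasInner (R : realType) V
    & NormedModule R V := {
  inner : V -> V -> R;
  innerC : forall x y, inner x y = inner y x;
  innerDl : forall x y z, inner (x + y) z = inner x z + inner y z;
  innerZl : forall a x y, inner (a *: x) y = a * inner x y;
  inner_norm : forall x, inner x x = `|x| ^+ 2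
}.

#[short(type="preHilbertType")]
HB.structure Definition PreHilbert (R : realType) :=
  {V of NormedModule R V & NormedModule_hasInner R V}.

#[short(type="hilbertType")]
HB.structure Definition Hilbert (R : realType) :=
  {V of CompleteNormedModule R V & PreHilbert R V}.

HB.factory Record Lmodule_isInner (R : realType) V & GRing.Lmodule R V := {
  inner : V -> V -> R;
  innerC : forall x y, inner x y = inner y x;
  innerDl : forall x y z, inner (x + y) z = inner x z + inner y z;
  innerZl : forall a x y, inner (a *: x) y = a * inner x y;
  inner_ge0 : forall x, 0 <= inner x x;
  inner_eq0 : forall x, inner x x = 0 -> x = 0
}.

HB.builders Context (R : realType) V & Lmodule_isInner R V.

Let nm (x : V) := Num.sqrt (inner x x).

Let cs x y : inner x y <= nm x * nm y.
Proof.
have [->|y0] := eqVneq y 0.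
  rewrite innerC -(scale0r (0 : V)) innerZl mul0r.
  by rewrite mulr_ge0 ?sqrtr_ge0.
have yy : 0 < inner y y.
  by rewrite lt_def inner_ge0 andbT; apply: contra_neq y0; exact: inner_eq0.
have h : inner x y ^+ 2 <= inner x x * inner y y.
  have := inner_ge0 (inner y y *: x + (- inner x y) *: y).
  rewrite innerDl !innerZl ![inner _ (_ + _)]innerC !innerDl !innerZl.
  rewrite (innerC y x) => H.
  rewrite -(ler_pM2l yy); nra.
rewrite -sqrtrM ?inner_ge0// (le_trans (ler_norm _))// -sqrtr_sqr.
by rewrite ler_sqrt// mulr_ge0 ?inner_ge0.
Qed.

Let ler_nmD x y : nm (x + y) <= nm x + nm y.
Proof.
rewrite -(@ler_pXn2r _ 2)// ?nnegrE ?addr_ge0 ?sqrtr_ge0// sqrrD.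
rewrite !sqr_sqrtr ?inner_ge0// innerDl ![inner _ (x + y)]innerC !innerDl.
by rewrite (innerC y x); have := cs x y; lra.
Qed.

Let nmZ a x : nm (a *: x) = `|a| * nm x.
Proof.
rewrite /nm innerZl innerC innerZl mulrA -expr2 sqrtrM ?sqr_ge0//.
by rewrite sqrtr_sqr.
Qed.

Let nm0_eq0 x : nm x = 0 -> x = 0.
Proof.
move=> /eqP; rewrite sqrtr_eq0 => h; apply: inner_eq0.
by apply/eqP; rewrite eq_le h inner_ge0.
Qed.

HB.instance Definition _ := Lmodule_isNormed.Build R V ler_nmD nmZ nm0_eq0.

Let inner_norm x : inner x x = `|x| ^+ 2.
Proof. by rewrite [`|x|]/(nm x) sqr_sqrtr ?inner_ge0. Qed.

HB.instance Definition _ := NormedModule_hasInner.Build R V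
  innerC innerDl innerZl inner_norm.

HB.end.

Section hprod.
Context {R : realType}.

(* The Hilbert direct sum.  It is an alias of the product type because the
   canonical norm on pairs is the max norm, which no inner product induces. *)
Definition hprod (H1 H2 : hilbertType R) : Type := (H1 * H2)%type.

Variables H1 H2 : hilbertType R.
Local Notation H := (hprod H1 H2).

HB.instance Definition _ := GRing.Lmodule.copy H (H1 * H2)%type.

Let ip (x y : H) : R := inner x.1 y.1 + inner x.2 y.2.

Let ipC x y : ip x y = ip y x.
Proof. by rewrite /ip innerC [inner x.2 _]innerC. Qed.

Let ipDl x y z : ip (x + y) z = ip x z + ip y z.
Proof. by rewrite /ip !innerDl addrACA. Qed.

Let ipZl a x y : ip (a *: x) y = a * ip x y.
Proof. by rewrite /ip !innerZl mulrDr. Qed.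

Let ip_ge0 x : 0 <= ip x x.
Proof. by rewrite /ip !inner_norm addr_ge0 ?sqr_ge0. Qed.

Let ip_eq0 x : ip x x = 0 -> x = 0.
Proof.
rewrite /ip !inner_norm => /eqP; rewrite paddr_eq0 ?sqr_ge0//.
by rewrite !sqrf_eq0 !normr_eq0 => /andP[/eqP x1 /eqP x2]; case: x x1 x2 => ? ? /= -> ->.
Qed.

HB.instance Definition _ := Lmodule_isInner.Build R H ipC ipDl ipZl ip_ge0 ip_eq0.

Lemma inner_hprodE (x y : H) : inner x y = inner x.1 y.1 + inner x.2 y.2.
Proof. by []. Qed.

Lemma norm_hprodE (x : H) : `|x| ^+ 2 = `|x.1| ^+ 2 + `|x.2| ^+ 2.
Proof. by rewrite -inner_norm inner_hprodE !inner_norm. Qed.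

Lemma hprod_norm1 (x : H) : `|x.1| <= `|x|.
Proof.
by rewrite -(@ler_pXn2r _ 2)// ?nnegrE// norm_hprodE lerDl sqr_ge0.
Qed.

Lemma hprod_norm2 (x : H) : `|x.2| <= `|x|.
Proof.
by rewrite -(@ler_pXn2r _ 2)// ?nnegrE// norm_hprodE lerDr sqr_ge0.
Qed.

Lemma hprod_norm_le (x : H) : `|x| <= `|x.1| + `|x.2|.
Proof.
rewrite -(@ler_pXn2r _ 2)// ?nnegrE ?addr_ge0// norm_hprodE sqrrD.
by rewrite -addrA lerD2l lerDr mulrn_wge0// mulr_ge0.
Qed.

Let hprod_complete (F : set_system H) : ProperFilter F -> cauchy F -> cvg F.
Proof.
move=> FF /cauchyP Fc.
have c1 : cvg (fst @ F : set_system H1).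
  apply: cauchy_cvg; apply/cauchyP => e e0; have [x xF] := Fc e e0.
  exists x.1; rewrite /= /nbhs /=; apply: filterS xF => y /=.
  rewrite -!ball_normE /= => h; exact: le_lt_trans (hprod_norm1 (x - y)) h.
have c2 : cvg (snd @ F : set_system H2).
  apply: cauchy_cvg; apply/cauchyP => e e0; have [x xF] := Fc e e0.
  exists x.2; rewrite /= /nbhs /=; apply: filterS xF => y /=.
  rewrite -!ball_normE /= => h; exact: le_lt_trans (hprod_norm2 (x - y)) h.
apply/cvg_ex; exists ((lim (fst @ F), lim (snd @ F)) : H).
apply/cvgrPdist_lt => e e0.
have e20 : 0 < e / 2 by rewrite divr_gt0.
move/cvgrPdist_lt : c1 => /(_ _ e20) h1.
move/cvgrPdist_lt : c2 => /(_ _ e20) h2.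
near=> x.
apply: le_lt_trans (hprod_norm_le _) _.
rewrite [ltRHS]splitr ltrD//=.
- by near: x; exact: h1.
- by near: x; exact: h2.
Unshelve. all: by end_near. Qed.

HB.instance Definition _ := Uniform_isComplete.Build H hprod_complete.

End hprod.

Section variational.
Context {R : realType}.

(* If x is isolated in Omega, the filter is improper, the limsup is -oo and
   every z is a normal. *)
Definition frechet_normal (X : hilbertType R) (Omega : set X) (x : X) : set X :=
  [set z | (limf_esup (fun u : X => (inner z (u - x) / `|u - x|)%:E)
             (within Omega x^') <= 0)%E].

Definition graph (H : hilbertType R) (f : H -> H) : set (hprod H H) :=
  [set p | p.2 = f p.1].

Definition coderivative (H : hilbertType R) (f : H -> H) (x y : H) : set H :=
  [set z | frechet_normal (graph f) ((x, f x) : hprod H H) (z, - y)].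

(* The value 0 is used only when no nearest point exists. *)
Definition metric_proj (H : hilbertType R) (C : set H) (x : H) : H :=
  xget 0 [set p | C p /\ forall z, C z -> `|x - p| <= `|x - z|].

End variational.

Section l2_def.
Context {R : realType}.

Definition square_summable : {pred (nat -> R)} :=
  mem [set x : nat -> R | cvgn (series (fun k => x k ^+ 2))].

Lemma square_summableP (x : nat -> R) :
  x \in square_summable <-> cvgn (series (fun k => x k ^+ 2)).
Proof. by split=> [/set_mem|/mem_set]. Qed.

Lemma square_summable_submod : submod_closed square_summable.
Proof.
split=> [|a x y /square_summableP xs /square_summableP ys].
  apply/square_summableP; rewrite (_ : series _ = cst 0); first exact: is_cvg_cst.
  by apply/funext => n; rewrite /series/= big1// => i _; rewrite expr0n.
apply/square_summableP.
apply: (@series_le_cvg _ _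
    (fun k => (2 * a ^+ 2) * x k ^+ 2 + 2 * y k ^+ 2)).
- by move=> k; exact: sqr_ge0.
- by move=> k; rewrite addr_ge0// mulr_ge0 ?sqr_ge0// mulr_ge0 ?sqr_ge0.
- move=> k; rewrite [X in X ^+ 2](_ : _ = a * x k + y k) //.
  have := sqr_ge0 (a * x k - y k); nra.
- exact: (is_cvg_seriesD (is_cvg_seriesZ (k := 2 * a ^+ 2) xs) (is_cvg_seriesZ (k := 2) ys)).
Qed.

HB.instance Definition _ :=
  GRing.isSubmodClosed.Build R (nat -> R) square_summable square_summable_submod.

End l2_def.

Record l2 (R : realType) := L2 {
  l2_seq :> nat -> R;
  l2P : l2_seq \in square_summable
}.

HB.instance Definition _ (R : realType) := [isSub for @l2_seq R].
HB.instance Definition _ (R : realType) := [Choice of l2 R by <:].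
HB.instance Definition _ (R : realType) := [SubChoice_isSubLmodule of l2 R by <:].

Section l2_hilbert.
Context {R : realType}.
Implicit Types x y z : l2 R.

Let ip x y : R := limn (series (fun k => x k * y k)).

Let ip_cvg x y : cvgn (series (fun k => x k * y k)).
Proof.
apply: normed_cvg; apply: (@series_le_cvg _ _ (fun k => x k ^+ 2 + y k ^+ 2)).
- by move=> k; exact: normr_ge0.
- by move=> k; rewrite addr_ge0 ?sqr_ge0.
- move=> k; rewrite /= normrM -(real_normK (num_real (x k))).
  rewrite -(real_normK (num_real (y k))).
  have := sqr_ge0 (`|x k| - `|y k|); have := sqr_ge0 (`|x k| + `|y k|); nra.
- by apply: is_cvg_seriesD; apply/square_summableP; exact: l2P.
Qed.

Let ipC x y : ip x y = ip y x.
Proof. by rewrite /ip; under eq_fun do rewrite mulrC. Qed.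

Let ipDl x y z : ip (x + y) z = ip x z + ip y z.
Proof.
rewrite /ip -(lim_seriesD (@ip_cvg x z) (@ip_cvg y z)).
by congr (limn (series _)); apply/funext => k; rewrite -[in RHS]mulrDl.
Qed.

Let ipZl a x y : ip (a *: x) y = a * ip x y.
Proof.
rewrite /ip -[RHS]/(a *: _) -(lim_seriesZ _ (@ip_cvg x y)).
by congr (limn (series _)); apply/funext => k; rewrite /= [RHS]mulrA.
Qed.

Let partial_le x n : \sum_(0 <= k < n) x k ^+ 2 <= ip x x.
Proof.
have := @ip_cvg x x; rewrite /ip; under eq_fun do rewrite -expr2.
move=> c; apply: (nondecreasing_cvgn_le _ c).
by apply: nondecreasing_series => k _ _; exact: sqr_ge0.
Qed.

Let ip_ge0 x : 0 <= ip x x.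
Proof. by have := partial_le x 0; rewrite big_nil. Qed.

Let coord_le x k : x k ^+ 2 <= ip x x.
Proof.
apply: le_trans (partial_le x k.+1); rewrite big_nat_recr//= lerDr.
by apply: sumr_ge0 => i _; exact: sqr_ge0.
Qed.

Let ip_eq0 x : ip x x = 0 -> x = 0.
Proof.
move=> x0; apply/val_inj/funext => k; have := coord_le x k; rewrite x0.
by move=> h; apply/eqP; rewrite -sqrf_eq0 eq_le h sqr_ge0.
Qed.

HB.instance Definition _ :=
  Lmodule_isInner.Build R (l2 R) ipC ipDl ipZl ip_ge0 ip_eq0.

Lemma inner_l2E x y : inner x y = limn (series (fun k => x k * y k)).
Proof. by []. Qed.

Lemma is_cvg_inner_l2 x y : cvgn (series (fun k => x k * y k)).
Proof. exact: ip_cvg. Qed.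

Lemma l2_coord_le x k : `|x k| <= `|x|.
Proof.
rewrite -(@ler_pXn2r _ 2)// ?nnegrE// -[leRHS]inner_norm.
by rewrite real_normK ?num_real//; exact: coord_le.
Qed.

Lemma l2_partial_le x n : \sum_(0 <= k < n) x k ^+ 2 <= `|x| ^+ 2.
Proof. by rewrite -inner_norm; exact: partial_le. Qed.

Lemma l2_norm_le x (c : R) : 0 <= c ->
  (forall n, \sum_(0 <= k < n) x k ^+ 2 <= c ^+ 2) -> `|x| <= c.
Proof.
move=> c0 h; rewrite -(@ler_pXn2r _ 2)// ?nnegrE// -inner_norm inner_l2E.
apply: limr_le; first exact: ip_cvg.
by apply: nearW => n; exact: h.
Qed.

Let l2_complete (F : set_system (l2 R)) : ProperFilter F -> cauchy F -> cvg F.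
Proof.
move=> FF /cauchyP Fc.
have ck k : cvg ((fun x : l2 R => x k) @ F).
  apply: cauchy_cvg; apply/cauchyP => e e0; have [x xF] := Fc e e0.
  exists (x k); rewrite /= /nbhs /=; apply: filterS xF => y /=.
  rewrite -!ball_normE /= => h; exact: le_lt_trans (l2_coord_le (x - y) k) h.
pose a k : R := lim ((fun x : l2 R => x k) @ F).
have key e : 0 < e -> \forall x \near F, forall n,
    \sum_(0 <= k < n) (a k - (x : l2 R) k) ^+ 2 <= e ^+ 2.
  move=> e0; have e20 : 0 < e / 2 by rewrite divr_gt0.
  have [w wF] := Fc (e / 2) e20.
  apply: filterS (wF) => x wx n.
  have c : \sum_(0 <= k < n) ((y : l2 R) k - x k) ^+ 2 @[y --> F] -->
      \sum_(0 <= k < n) (a k - x k) ^+ 2.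
    apply: (@cvg_big _ _ _ _ xpredT) => [|k _]; first exact: add_continuous.
    by under eq_fun do rewrite expr2; apply: cvgM; apply: cvgB;
      first [exact: ck | exact: cvg_cst].
  apply: (cvgr_to_le c).
  apply: filterS wF => y wy.
  apply: le_trans (l2_partial_le (y - x) n) _.
  rewrite ler_pXn2r ?nnegrE ?(ltW e0)// ltW//.
  move: wx wy; rewrite -!ball_normE /= => wx wy.
  rewrite -(subrKA w) [ltRHS]splitr (le_lt_trans (ler_normD _ _))// ltrD//.
  by rewrite distrC.
have aS : a \in square_summable.
  have [x xa] := filter_ex (key 1 ltr01).
  have ax : (fun k => a k - x k) \in square_summable.
    apply/square_summableP/nondecreasing_is_cvgn.
      by apply: nondecreasing_series => k _ _; exact: sqr_ge0.
    by exists (1 ^+ 2) => _ [n _ <-]; exact: xa.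
  have -> : a = (fun k => a k - x k) + (x : nat -> R).
    by apply/funext => k /=; rewrite -[RHS]/(a k - x k + x k) subrK.
  by apply: rpredD => //; exact: l2P.
apply/cvg_ex; exists (L2 aS); apply/cvgrPdist_le => e e0.
apply: filterS (key e e0) => x h.
by apply: l2_norm_le; [exact: ltW|exact: h].
Qed.

HB.instance Definition _ := Uniform_isComplete.Build (l2 R) l2_complete.

End l2_hilbert.

(* Coordinates are indexed from 0, so that nat stands for the positive
   integers. *)
Section cones.
Context {R : realType}.
Implicit Types (N : set nat) (x y z : l2 R).

Definition positive_cone : set (l2 R) := [set x | forall i, 0 <= x i].

Definition coneK N : set (l2 R) := [set x | forall i, N i -> 0 <= x i].

Definition bdryK N : set (l2 R) :=
  [set x | coneK N x /\ forall i, N i -> x i = 0].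

Definition coneZ N : set (l2 R) :=
  [set x | (forall i, N i -> 0 < x i) /\ (forall i, (~` N) i -> x i = 0)].

Definition preceq N z y : Prop :=
  (forall i, N i -> z i <= y i) /\ (forall i, (~` N) i -> z i = y i).

End cones.

(* Main.v *)
(** The projection onto the positive cone is the coordinatewise positive part,
    hence nonexpansive.  A Fréchet normal to its graph is tested along rays:
    for y = 0, nonexpansiveness along the ray in the direction of a candidate z
    itself forces z = 0; at a point of [coneZ M], the rays along the basis
    vectors and their opposites give z i = y i on M and 0 <= z i <= y i off M.
    Conversely these conditions suffice, because every coordinate contributes a
    nonpositive term to the inner product near such a point. *)

Require Import Defs.
From mathcomp Require Import all_boot all_order all_algebra.
From mathcomp Require Import all_classical all_reals all_analysis.
From mathcomp Require Import ring lra.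
Set Implicit Arguments.
Unset Strict Implicit.
Unset Printing Implicit Defensive.
Import Order.TTheory GRing.Theory Num.Theory.
Import numFieldNormedType.Exports.
Local Open Scope classical_set_scope.
Local Open Scope ring_scope.

(** * Fréchet normals and coderivatives in a Hilbert space *)

Lemma inner0r {R : realType} {X : hilbertType R} (z : X) : inner z 0 = 0.
Proof. by rewrite innerC -(scale0r (0 : X)) innerZl mul0r. Qed.

Lemma innerZr {R : realType} {X : hilbertType R} (a : R) (x y : X) :
  inner x (a *: y) = a * inner x y.
Proof. by rewrite innerC innerZl innerC. Qed.

Lemma innerNl {R : realType} {X : hilbertType R} (x y : X) :
  inner (- x) y = - inner x y.
Proof. by rewrite -scaleN1r innerZl mulN1r. Qed.

(** The set of [u] with nonpositive inner product bounds the limsup: every quotient over it is at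
    most 0, including the one at [u = x], where division by zero gives 0. *)
Lemma normal_of_nonpos {R : realType} {X : hilbertType R} (Omega : set X)
    (x z : X) :
  (\forall u \near x, Omega u -> inner z (u - x) <= 0) ->
  frechet_normal Omega x z.
Proof.
move=> zx; apply: ge_ereal_inf.
eexists; first by exists [set u | inner z (u - x) <= 0] => //;
  apply: filterS zx => u + _.
apply: ge_ereal_sup => _ [u zu <-].
by rewrite lee_fin mulr_le0_ge0 ?invr_ge0.
Qed.

(** If [a] were positive, the points [c t] would tend to [x] inside [Omega] with difference
    quotients above a fixed positive constant, against the bound on the limsup. *)
Lemma normal_path {R : realType} {X : hilbertType R} (Omega : set X)
    (x z : X) (c : R -> X) (a C : R) :
  frechet_normal Omega x z ->
  (\forall t \near (0 : R)^'+, [/\ Omega (c t), `|c t - x| <= t * C &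
     t * a <= inner z (c t - x)]) ->
  a <= 0.
Proof.
rewrite /frechet_normal/= => zN cP; rewrite leNgt; apply/negP => a0.
(* Adding 1 keeps the denominator positive for every real [C]. *)
have K0 : 0 < `|C| + 1 by rewrite ltr_wpDl.
have aK : 0 < a / (`|C| + 1) by rewrite divr_gt0.
have : (limf_esup (fun u : X => (inner z (u - x) / `|u - x|)%:E)
    (within Omega x^') < (a / (`|C| + 1))%:E)%E.
  by apply: le_lt_trans zN _; rewrite lte_fin.
move=> /ereal_inf_ltP[_ [V VF <-]] Va.
have /nbhs_ballP[e /= e0 eV] : nbhs x [set u | u != x -> Omega u -> V u] by [].
(* The right neighborhoods of 0 form a proper filter, so a contradiction at a generic small [t] is
   enough. *)
have : \forall t \near (0 : R)^'+, False; last by move/filter_ex => [].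
near=> t.
have t0 : 0 < t by [].
have [Oct ctC cta] : [/\ Omega (c t), `|c t - x| <= t * C &
    t * a <= inner z (c t - x)] by near: t.
have ctx : c t != x.
  apply: contraTneq cta => ->; rewrite subrr inner0r -ltNge.
  by rewrite mulr_gt0.
have n0 : 0 < `|c t - x| by rewrite normr_gt0 subr_eq0.
have ctK : `|c t - x| <= t * (`|C| + 1).
  by apply: le_trans ctC _; rewrite ler_pM2l// (le_trans (ler_norm C))// lerDl.
have Vct : V (c t).
  apply: eV => //; rewrite -ball_normE /= distrC; apply: le_lt_trans ctK _.
  rewrite -ltr_pdivlMr//; near: t; apply: nbhs_right_lt.
  by rewrite divr_gt0.
have := ereal_sup_ubound (imageP (fun u => (inner z (u - x) / `|u - x|)%:E) Vct).
move=> /le_lt_trans /(_ Va); rewrite lte_fin ltr_pdivrMr// ltNge => /negP; apply.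
apply: le_trans cta; rewrite mulrAC ler_pdivrMr//.
by rewrite -mulrA [leRHS]mulrCA ler_pM2l.
Unshelve. all: by end_near. Qed.

Lemma coderivative_of_le {R : realType} (H : hilbertType R) (f : H -> H)
    (x y z : H) :
  (\forall u \near x, inner z (u - x) <= inner y (f u - f x)) ->
  coderivative f x y z.
Proof.
move=> /nbhs_ballP[e /= e0 zy]; apply: normal_of_nonpos.
apply/(nbhs_ballP (M := hprod H H)); exists e => // -[u v] + uv; have {uv}-> : v = f u by [].
rewrite -ball_normE /= => /(le_lt_trans (hprod_norm1 _)) /= xu.
rewrite inner_hprodE /= innerNl subr_le0; apply: zy.
by rewrite -ball_normE.
Qed.

Lemma coderivative_nonexpansive0 {R : realType} (H : hilbertType R)
    (f : H -> H) (x : H) :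
  (forall u v, `|f u - f v| <= `|u - v|) ->
  coderivative f x 0 = [set 0].
Proof.
move=> f1; apply/seteqP; split=> [z|_ ->]; last first.
  by apply: coderivative_of_le; apply: nearW => u; rewrite ![inner 0 _]innerC !inner0r.
rewrite /coderivative/= => zN.
have {zN} : inner z z <= 0.
  (* The curve is the graph over the ray from [x] along [z]; nonexpansiveness bounds both of its
     components by [t] times the norm of [z], hence the factor 2. *)
  apply: (normal_path (C := 2 * `|z|)
    (c := fun t => ((x + t *: z, f (x + t *: z)) : hprod H H)) zN).
  near=> t; have t0 : 0 < t by [].
  split=> //.
  - apply: le_trans (hprod_norm_le _) _ => /=.
    have -> : t * (2 * `|z|) = `|t *: z| + `|t *: z|.
      by rewrite normrZ gtr0_norm//; ring.
    rewrite lerD//; first by rewrite addrC addKr.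
    by apply: le_trans (f1 _ _) _; rewrite addrC addKr.
  - rewrite inner_hprodE/= oppr0 [inner 0 _]innerC inner0r addr0.
    by rewrite addrC addKr innerZr.
rewrite inner_norm => z0; apply/eqP; rewrite -normr_eq0 -sqrf_eq0.
by rewrite eq_le z0 sqr_ge0.
Unshelve. all: by end_near. Qed.

(** Where [f] is affine along a ray, with slope [q], normality tested on that ray becomes a linear
    inequality; well-chosen directions [d] then bound single coordinates of [z]. *)
Lemma coderivative_ray {R : realType} (H : hilbertType R) (f : H -> H)
    (x y z d q : H) :
  coderivative f x y z ->
  (\forall t \near (0 : R)^'+, f (x + t *: d) = f x + t *: q) ->
  inner z d <= inner y q.
Proof.
rewrite /coderivative/= => zN fq; rewrite -subr_le0.
apply: (normal_path (C := `|d| + `|q|)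
  (c := fun t => ((x + t *: d, f (x + t *: d)) : hprod H H)) zN).
near=> t; have t0 : 0 < t by [].
have ft : f (x + t *: d) = f x + t *: q by near: t.
split=> //.
- apply: le_trans (hprod_norm_le _) _; rewrite /= ft.
  by rewrite ![_ + t *: _ - _]addrAC !subrr !add0r !normrZ gtr0_norm// mulrDr.
- rewrite inner_hprodE/= ft ![_ + t *: _ - _]addrAC !subrr !add0r.
  by rewrite innerNl !innerZr mulrBr.
Unshelve. all: by end_near. Qed.

(** * Coordinatewise comparison and basis vectors in [l2] *)

Lemma inner_l2_ge0 {R : realType} (x y : l2 R) :
  (forall i, 0 <= x i * y i) -> 0 <= inner x y.
Proof.
move=> xy; rewrite inner_l2E; apply: limr_ge; first exact: is_cvg_inner_l2.
by apply: nearW => n; rewrite /series/=; apply: sumr_ge0.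
Qed.

Lemma norm_l2_le {R : realType} (x y : l2 R) :
  (forall i, `|x i| <= `|y i|) -> `|x| <= `|y|.
Proof.
move=> xy; apply: l2_norm_le => // n; apply: le_trans (l2_partial_le y n).
apply: ler_sum => i _.
by rewrite -[leLHS]real_normK ?num_real// -[leRHS]real_normK ?num_real// ler_pXn2r.
Qed.

Lemma series_mul_delta {R : realType} (f : nat -> R) (i : nat) :
  \forall n \near \oo, series (fun k => f k * (k == i)%:R) n = f i.
Proof.
(* Partial sums stop before [n], so the index [i] is included from [n = i + 1] on. *)
exists i.+1 => // n /= ni; rewrite /series/= (bigD1_seq i) ?iota_uniq//=.
  by rewrite eqxx mulr1 big1 ?addr0// => k /negPf ->; exact: mulr0.
by rewrite mem_index_iota.
Qed.

Lemma delta_in_l2 {R : realType} (i : nat) :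
  (fun k => (k == i)%:R : R) \in square_summable.
Proof.
apply/square_summableP; apply/cvg_ex; exists 1; apply: cvg_near_cst.
have := series_mul_delta (fun k => (k == i)%:R : R) i.
by rewrite eqxx.
Qed.

Definition l2_basis {R : realType} (i : nat) : l2 R := L2 (delta_in_l2 i).

Lemma inner_l2_basis {R : realType} (z : l2 R) (i : nat) :
  inner z (l2_basis i) = z i.
Proof.
rewrite inner_l2E; apply: lim_near_cst; first exact: Rhausdorff.
exact: series_mul_delta.
Qed.

(** * The projection onto the positive cone *)

Lemma pos_part_in_l2 {R : realType} (x : l2 R) :
  (fun k => Num.max (x k) 0) \in square_summable.
Proof.
apply/square_summableP; apply: (@series_le_cvg _ _ (fun k => x k ^+ 2)).
- by move=> k; exact: sqr_ge0.
- by move=> k; exact: sqr_ge0.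
- by move=> k /=; case: (lerP (x k) 0) => //; rewrite expr0n sqr_ge0.
- by apply/square_summableP; exact: l2P.
Qed.

Definition pos_part {R : realType} (x : l2 R) : l2 R := L2 (pos_part_in_l2 x).

Lemma l2D {R : realType} (x y : l2 R) i : (x + y) i = x i + y i.
Proof. by []. Qed.

Lemma l2N {R : realType} (x : l2 R) i : (- x) i = - x i.
Proof. by []. Qed.

Lemma l2Z {R : realType} (a : R) (x : l2 R) i : (a *: x) i = a * x i.
Proof. by []. Qed.

(** In each coordinate either [x - pos_part x] vanishes, or [pos_part x] does and both factors [x i]
    and [- p i] are nonpositive. The inner product is thus nonnegative, and the resulting
    Pythagorean inequality [pyth] gives both minimality and uniqueness. *)
Lemma metric_proj_positive_cone {R : realType} (x : l2 R) :
  metric_proj positive_cone x = pos_part x.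
Proof.
have pos_pos : positive_cone (pos_part x).
  by move=> i /=; rewrite le_max lexx orbT.
have pyth p : positive_cone p ->
    `|x - pos_part x| ^+ 2 + `|pos_part x - p| ^+ 2 <= `|x - p| ^+ 2.
  move=> p0.
  have : 0 <= inner (x - pos_part x) (pos_part x - p).
    apply: inner_l2_ge0 => i; rewrite !l2D !l2N /=; have := p0 i.
    by case: (lerP (x i) 0) => ? ?; nra.
  have -> : x - p = (x - pos_part x) + (pos_part x - p) by rewrite addrA subrK.
  move: (x - _) (_ - p) => u v uv; rewrite -3!inner_norm innerDl.
  rewrite ![inner _ (u + v)]innerC !innerDl (innerC v u); lra.
apply: xget_unique.
  split=> // p /pyth h; rewrite -(@ler_pXn2r _ 2)// ?nnegrE//.
  by apply: le_trans h; rewrite lerDl sqr_ge0.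
move=> p [p0 /(_ _ pos_pos)]; rewrite -(@ler_pXn2r _ 2)// ?nnegrE// => h.
have := pyth _ p0 => /le_trans /(_ h); rewrite gerDl => h'.
by apply/esym/eqP; rewrite -subr_eq0 -normr_eq0 -sqrf_eq0 eq_le h' sqr_ge0.
Qed.

Lemma metric_proj_positive_cone_nonexpansive {R : realType} (u v : l2 R) :
  `|metric_proj positive_cone u - metric_proj positive_cone v| <= `|u - v|.
Proof.
rewrite !metric_proj_positive_cone; apply: norm_l2_le => i.
rewrite !l2D !l2N /=.
case: (lerP (u i) 0) => u0; case: (lerP (v i) 0) => v0;
  rewrite ?subrr ?normr0// ?sub0r ?subr0 ?normrN.
- by rewrite gtr0_norm// distrC; apply: le_trans (ler_norm _); lra.
- by rewrite gtr0_norm//; apply: le_trans (ler_norm _); lra.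
Qed.

(** * The coderivative of the projection at points of [coneZ M] *)

(* Finiteness of M keeps all the coordinates in M nonnegative on a whole
   neighborhood of xbar. *)
Lemma coderivative_proj_coneZ {R : realType} (M : set nat) (xbar y z : l2 R) :
  finite_set M -> coneZ M xbar ->
  coderivative (metric_proj positive_cone) xbar y z <->
    (forall i, M i -> z i = y i) /\ (forall i, (~` M) i -> 0 <= z i <= y i).
Proof.
move=> Mfin [xM xM'].
have x0 i : 0 <= xbar i by have [/xM/ltW|/xM' ->] := pselect (M i).
have Px : pos_part xbar = xbar by apply/val_inj/funext => i; apply/max_idPl.
have -> : metric_proj positive_cone = @pos_part R.
  by apply/funext => u; exact: metric_proj_positive_cone.
split=> [zP|[zyM zyM']].
  (* Moving along a basis vector stays in the cone, where the projection is the identity. *)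
  have up i : z i <= y i.
    rewrite -!inner_l2_basis; apply: coderivative_ray zP _.
    near=> t; have t0 : 0 < t by [].
    rewrite Px; apply/val_inj/funext => k; apply/max_idPl.
    by rewrite !l2D !l2Z /= addr_ge0 ?mulr_ge0// ltW.
  split=> i Mi.
    (* On [M] the coordinate [xbar i] is positive, so short backward steps also stay in the cone. *)
    suff : inner z (- 1 *: l2_basis i) <= inner y (- 1 *: l2_basis i).
      by rewrite !innerZr !inner_l2_basis !mulN1r lerN2 => lo; apply/le_anti/andP.
    apply: coderivative_ray zP _.
    near=> t; have t0 : 0 < t by [].
    rewrite Px; apply/val_inj/funext => k; apply/max_idPl.
    rewrite !l2D !l2Z /=; have [->|ki] := eqVneq k i.
      rewrite mulr1 mulrN1 subr_ge0; apply: ltW; near: t.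
      by apply: nbhs_right_lt; exact: xM.
    by rewrite !mulr0 addr0.
  rewrite up andbT.
  (* Off [M] the coordinate [xbar i] is 0, so a backward step is projected back to [xbar]: the slope
     is 0. *)
  suff : inner z (- 1 *: l2_basis i) <= inner y 0.
    by rewrite innerZr inner_l2_basis inner0r mulN1r oppr_le0.
  apply: coderivative_ray zP _.
  near=> t; have t0 : 0 < t by [].
  rewrite scaler0 addr0 Px; apply/val_inj/funext => k.
  rewrite -[LHS]/(Num.max ((xbar + t *: (- 1 *: l2_basis i)) k) 0).
  rewrite !l2D !l2Z /=; have [->|ki] := eqVneq k i.
    rewrite xM'// add0r; apply/max_idPr.
    by rewrite mulr1 mulrN1 oppr_le0 ltW.
  by rewrite !mulr0 addr0; apply/max_idPl.
have /finite_fsetP[D MD] := Mfin.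
apply: coderivative_of_le.
have : nbhs xbar (\bigcap_(i in M) [set v : l2 R | 0 <= v i]).
  rewrite {1}MD; apply: filter_bigI => i iD.
  have /xM xi : M i by rewrite MD.
  (* A coordinate moves by at most the norm of the displacement, hence this radius. *)
  apply/nbhs_ballP; exists (xbar i) => //= u.
  rewrite -ball_normE /= => /(le_lt_trans (l2_coord_le _ i)).
  rewrite l2D l2N ltr_norml => /andP[_]; rewrite ltrBlDr ltrDl => /ltW //.
apply: filterS => u uM; rewrite Px -subr_ge0.
(* Splitting the displacement at [pos_part u] leaves two inner products, each nonnegative coordinate
   by coordinate. *)
have -> : u - xbar = (pos_part u - xbar) - (pos_part u - u).
  by rewrite opprB [RHS]addrC subrKA.
have -> : inner y (pos_part u - xbar) -
      inner z ((pos_part u - xbar) - (pos_part u - u)) =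
    inner (y - z) (pos_part u - xbar) + inner z (pos_part u - u).
  move: (_ - xbar) (_ - u) => p q; rewrite [inner z (_ - _)]innerC !innerDl !innerNl.
  by rewrite ![inner _ z]innerC; lra.
(* First product: [y - z] vanishes on [M], and off [M] both factors are nonnegative as [xbar]
   vanishes. Second: [pos_part u - u] vanishes on [M], and off [M] both factors are nonnegative. *)
apply: addr_ge0; apply: inner_l2_ge0 => i; rewrite !l2D !l2N /=.
  have [/zyM ->|Mi] := pselect (M i); first by rewrite subrr mul0r.
  rewrite xM'// subr0 mulr_ge0// ?le_max ?lexx ?orbT// subr_ge0.
  by case/andP: (zyM' _ Mi).
have [Mi|Mi] := pselect (M i).
  by rewrite max_l ?subrr ?mulr0//; apply: uM.
by rewrite mulr_ge0 ?subr_ge0 ?le_max ?lexx//; case/andP: (zyM' _ Mi).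
Unshelve. all: by end_near. Qed.

Theorem theorem5p1 (R : realType) (M : set nat)
    (M_neq0 : M !=set0) (M_fin : finite_set M) :
  let P : l2 R -> l2 R := metric_proj positive_cone in
  [/\ forall xbar : l2 R, coderivative P xbar 0 = [set 0],
      forall xbar : l2 R, coneZ M xbar ->
        forall y : l2 R, coneK (~` M) y <-> coderivative P xbar y y
    & forall xbar : l2 R, coneZ M xbar ->
        (forall y : l2 R, coneK (~` M) y ->
           coderivative P xbar y =
             [set z : l2 R | coneK (~` M) z /\ preceq (~` M) z y]) /\
        (forall y : l2 R, bdryK (~` M) y -> coderivative P xbar y = [set y])].
Proof.
split=> [xbar|xbar xZ y|xbar xZ].
- by apply: coderivative_nonexpansive0; exact: metric_proj_positive_cone_nonexpansive.
- split=> [yK|/(coderivative_proj_coneZ y y M_fin xZ)[_ yK] i Mi].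
    apply/(coderivative_proj_coneZ y y M_fin xZ).
    by split=> // i /yK ->; rewrite lexx.
  by have /andP[] := yK _ Mi.
- split=> [y yK|y [yK y0]]; apply/seteqP; split=> z /=.
  + move=> /(coderivative_proj_coneZ y z M_fin xZ)[zy zyM].
    split; first by move=> i Mi; have /andP[] := zyM _ Mi.
    split=> i; first by move=> Mi; have /andP[] := zyM _ Mi.
    by rewrite setCK; exact: zy.
  + move=> [zK [zy zyM]]; apply/(coderivative_proj_coneZ y z M_fin xZ).
    split=> i Mi; first by apply: zyM; rewrite setCK.
    by rewrite zK//= zy.
  + move=> /(coderivative_proj_coneZ y z M_fin xZ)[zy zyM].
    (* Off [M] the coordinate [y i] is 0, so [z i] is squeezed between 0 and 0. *)
    apply/val_inj/funext => i; have [/zy//|Mi] := pselect (M i).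
    have := zyM _ Mi; rewrite (y0 _ Mi) => /andP[z0 z0'].
    by rewrite -[RHS]/(y i) (y0 _ Mi); apply: le_anti; apply/andP.
  + move=> ->; apply/(coderivative_proj_coneZ y y M_fin xZ).
    by split=> // i /y0 ->; rewrite lexx.
Qed.
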